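(* Let $A=\mathrm{diag}(n_1,\,I_{s_2}+n_2,\,\dots,\,(k-1)I_{s_k}+n_k)$ (block diagonal), where each $n_i$ is a nilpotent complex matrix of dimension $s_i\ge1$ and $\sum_{i=1}^ks_i=n$, with $n\ge2$. Let $\alpha_2,\dots,\alpha_{n-1}$ be complex numbers. The general nilpotent solution $X\in\mathcal{M}_n(\mathbb{C})$ of the equation $$XA-AX=X+\sum_{i=2}^{n-1}\alpha_iX^i$$ is a strictly upper triangular $k\times k$ block matrix $X$. Let $1\le i\le k-1$. Knowing the false block diagonals of $X$ with indices $j<i$, the false block diagonal of $X$ with index $i$ can be obtained by the resolution of $k-i$ similar Sylvester equations.
   Context: The $k\times k$ block structure of $X=[x_{ij}]$ is the one induced by $A$, that is, the block $x_{ij}$ has size $s_i\times s_j$. The false block diagonal with index $i$ of a strictly upper triangular $k\times k$ block matrix $X=[x_{ij}]$ is the family of blocks $x_{1,1+i},x_{2,2+i},\dots,x_{k-i,k}$. A Sylvester equation is a matrix equation of the form $xB-Cx=D$, where the square matrices $B,C$ and the matrix $D$ are given and $x$ is the unknown matrix. *)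

(* Defs.v *)
From HB Require Import structures.
From mathcomp Require Export all_boot all_order all_algebra.
From mathcomp Require Export reals complex.

Set Implicit Arguments.
Unset Strict Implicit.
Unset Printing Implicit Defensive.

Import GRing.Theory.
Local Open Scope ring_scope.

Definition nilpotent_mx (F : pzRingType) (n : nat) (X : 'M[F]_n) : Prop :=
  exists m : nat, X ^+ m = 0.

Definition sylvester (F : pzRingType) (m n : nat)
    (B : 'M[F]_n) (C : 'M[F]_m) (D x : 'M[F]_(m, n)) : Prop :=
  x *m B - C *m x = D.

Section Blocks.
Variables (F : pzRingType) (k : nat) (s : 'I_k -> nat).
Notation n := (\sum_(i < k) s i)%N.

(* Block indices start at 0, so the scalar in the p-th diagonal block is p. *)
Definition shifted_diag (N : forall p, 'M[F]_(s p)) : 'M[F]_n :=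
  \mxdiag_(p < k) ((p%:R)%:M + N p).

Definition strictly_upper_block (X : 'M[F]_n) : Prop :=
  forall p q : 'I_k, (q <= p)%N -> submxblock X p q = 0.

(* X with every block set to 0 except the false block diagonals of index j,
   0 < j < i. *)
Definition lower_diags (i : nat) (X : 'M[F]_n) : 'M[F]_n :=
  \mxblock_(p < k, q < k)
    (if (p < q < p + i)%N then submxblock X p q else 0).

Definition same_lower_diags (i : nat) (X Y : 'M[F]_n) : Prop :=
  forall p q : 'I_k, (p < q < p + i)%N -> submxblock X p q = submxblock Y p q.

Variable alpha : nat -> F.

Definition higher_terms (X : 'M[F]_n) : 'M[F]_n :=
  \sum_(2 <= m < n) alpha m *: X ^+ m.

Definition nilpotent_solution (A X : 'M[F]_n) : Prop :=
  nilpotent_mx X /\ X *m A - A *m X = X + higher_terms X.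

(* Block (p, q), q = p + i, of the equation XA - AX = X + higher_terms X, with
   the unknown block x = x_(p, q): one gets
   x (q I + N_q) - (p I + N_p) x - x = x ((i - 1) I + N_q) - N_p x on the left,
   and for strictly upper triangular X the (p, q) block of X^m, m >= 2, only
   involves the false block diagonals of index j < i. *)
Definition diag_sylvester (N : forall p, 'M[F]_(s p)) (i : nat) (X : 'M[F]_n)
    (p q : 'I_k) (x : 'M[F]_(s p, s q)) : Prop :=
  sylvester (((i.-1)%:R)%:M + N q) (N p)
    (submxblock (higher_terms (lower_diags i X)) p q) x.

End Blocks.

(* Main.v *)
Require Import Defs.
From mathcomp Require Import ring.

(** Write A for the block diagonal matrix, h(Y) for the sum of the alpha_i Y^i,
i >= 2, and E(Y) = YA - AY - Y - h(Y) for the residual of the equation.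
Everything rests on the formula
  (ZA - AZ)_pq = (q - p) Z_pq + Z_pq N_q - N_p Z_pq
and on the Sylvester equation x (c I + B) - C x = D with B, C nilpotent and
c <> 0: here U = c I + B is invertible, and the unique solution is the finite
sum of the C^j D U^-(j+1) ([sylvester_uniq], [sylvester_exists]).

A nilpotent solution X commutes with X + h(X) = XA - AX, so
X^m A - A X^m = m X^m + m X^(m-1) h(X).  If every power of X beyond the m-th is
strictly upper triangular, then for q <= p the block (p, q) of this identity
reads x ((q - p - m) I + N_q) - N_p x = 0 with x = (X^m)_pq and q - p - m < 0,
so x = 0.  Downward induction on m, started at a vanishing power, reaches m = 1
([nilpotent_solution_strictly_upper]).

For the rest, filter the matrices by the index of their first nonzero false
block diagonal ([above_diag]).  Changing a strictly upper triangular matrix from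
index M on changes h only from index M + 1 on ([higher_terms_above_diagB]),
because every monomial of h has degree at least 2.  Hence the block (p, p + M)
of E(Y + Z), for Z supported from index M on, is that of E(Y) plus
  z ((M - 1) I + N_q) - N_p z,  z = Z_pq, q = p + M.
Applied to X and its truncation, this gives the Sylvester equations satisfied by
X.  Conversely, Sylvester solutions on a false diagonal push the residual one
index further ([residual_correction]).  Given any solutions x on the diagonal of
index d, add them to the truncation of X; the residual then starts at an index
M >= d + 1 >= 2, where M - 1 <> 0, so all later diagonals can be solved for in
turn until the residual vanishes ([complete_solution]). *)

Set Implicit Arguments.
Unset Strict Implicit.
Unset Printing Implicit Defensive.
Import GRing.Theory Num.Theory.
Local Open Scope ring_scope.

(** * Powers under a commutator, and Sylvester equations with nilpotent data *)

(** The power rule for the derivation x |-> x a - a x, valid when its value at x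
commutes with x. *)
Lemma commutator_exp (R : pzRingType) (x a f : R) (m : nat) :
    GRing.comm x f -> x * a - a * x = f ->
  x ^+ m.+1 * a - a * x ^+ m.+1 = (x ^+ m * f) *+ m.+1.
Proof.
move=> xf xa; elim: m => [|m IHm]; first by rewrite expr1 mul1r mulr1n.
have -> : x ^+ m.+2 * a - a * x ^+ m.+2
    = x * (x ^+ m.+1 * a - a * x ^+ m.+1) + (x * a - a * x) * x ^+ m.+1.
  by rewrite mulrBr mulrBl !mulrA -exprS -[a * x * _]mulrA -exprS addrA subrK.
rewrite IHm xa mulrnAr mulrA -exprS -(commrX m.+1 (commr_sym xf)).
by rewrite [RHS]mulrSr.
Qed.

Section Sylvester.
Variables (F : fieldType) (m n : nat) (B : 'M[F]_n) (C : 'M[F]_m) (c : F).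
Hypotheses (c0 : c != 0) (nilB : nilpotent_mx B) (nilC : nilpotent_mx C).

Lemma unitmx_scalarD_nilpotent : c%:M + B \in unitmx.
Proof.
(* c^r - (-B)^r = c^r factors through c + B. *)
have [r Br] := nilB.
have com : GRing.comm c%:M (- B) by apply: commrN; apply: comm_scalar_mx.
have := subrXX_comm r com; rewrite opprK exprNn Br mulr0 subr0.
set S := (\sum_(i < r) _) => e.
have e' : c%:M ^+ r = (c ^+ r)%:M :> 'M[F]_n.
  elim: (r) => [|j IHj]; first by rewrite !expr0.
  by rewrite exprS IHj exprS scalar_mxM.
have : (c%:M + B) *m ((c ^+ r)^-1 *: S) = 1%:M.
  rewrite -scalemxAr [_ *m S](esym e) e' scale_scalar_mx mulVf //.
  by rewrite expf_neq0.
by case/mulmx1_unit.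
Qed.

Lemma sylvester_uniq (x : 'M_(m, n)) : sylvester (c%:M + B) C 0 x -> x = 0.
Proof.
have Uu := unitmx_scalarD_nilpotent; set U := c%:M + B in Uu *.
rewrite /sylvester => /subr0_eq xU.
(* The equation says x = C x U^-1; iterate it until C^j vanishes. *)
have x_iter j : x = C ^+ j *m x *m invmx U ^+ j.
  elim: j => [|j IHj]; first by rewrite !expr0 mul1mx mulmx1.
  rewrite exprSr exprS -[C ^+ j * C]/(C ^+ j *m C).
  rewrite -[invmx U * _]/(invmx U *m _).
  by rewrite -[C ^+ j *m C *m x]mulmxA -xU -!mulmxA mulKVmx // mulmxA -IHj.
by have [r Cr] := nilC; rewrite (x_iter r) Cr !mul0mx.
Qed.

Lemma sylvester_exists (D : 'M_(m, n)) :
  exists x, sylvester (c%:M + B) C D x.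
Proof.
have Uu := unitmx_scalarD_nilpotent; set U := c%:M + B in Uu *.
have [r Cr] := nilC.
(* The finite geometric sum of the C^j D U^-(j+1); U and C telescope it. *)
pose T j := C ^+ j *m D *m invmx U ^+ j.
have TU j : T j *m invmx U *m U = T j by rewrite mulmxKV.
have CT j : C *m (T j *m invmx U) = T j.+1.
  rewrite /T exprS exprSr -[C * _]/(C *m _) -[_ * invmx U]/(_ *m invmx U).
  by rewrite !mulmxA.
exists (\sum_(j < r) T j *m invmx U); rewrite /sylvester.
rewrite mulmx_suml mulmx_sumr -sumrB.
under eq_bigr do rewrite TU CT -opprB.
rewrite sumrN -(big_mkord xpredT (fun j => T j.+1 - T j)) telescope_sumr //.
by rewrite /T Cr !mul0mx !expr0 mul1mx mulmx1 sub0r opprK.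
Qed.

End Sylvester.

(** * The filtration by false block diagonals *)

Section Blocks.
Variables (F : numFieldType) (k : nat) (s : 'I_k -> nat).
Local Notation n := (\sum_(i < k) s i)%N.
Implicit Types (X Y Z : 'M[F]_n).

(** The matrix is supported on the false block diagonals of index at least m;
index 0 means block upper triangular, index 1 strictly so. *)
Definition above_diag (m : nat) Z : Prop :=
  forall p q : 'I_k, (q < p + m)%N -> submxblock Z p q = 0.

Lemma strictly_upperP Z : strictly_upper_block Z <-> above_diag 1 Z.
Proof.
by split=> h p q; [move=> l | move=> l]; apply: h; move: l; rewrite addn1 ltnS.
Qed.

Lemma submxblockN Z p q : submxblock (- Z) p q = - submxblock Z p q.
Proof. by apply/matrixP=> i j; rewrite !mxE. Qed.

Lemma submxblockB Y Z p q :
  submxblock (Y - Z) p q = submxblock Y p q - submxblock Z p q.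
Proof. by rewrite submxblockD submxblockN. Qed.

Lemma submxblockZ (a : F) Z p q : submxblock (a *: Z) p q = a *: submxblock Z p q.
Proof. by apply/matrixP=> i j; rewrite !mxE. Qed.

Lemma submxblockM Y Z p q :
  submxblock (Y *m Z) p q = \sum_r submxblock Y p r *m submxblock Z r q.
Proof. by rewrite -{1}[Y]submxblockK -{1}[Z]submxblockK mul_mxblock mxblockK. Qed.

Lemma above_diag0 m : above_diag m 0.
Proof. by move=> p q _; rewrite submxblock0. Qed.

Lemma above_diagD m Y Z :
  above_diag m Y -> above_diag m Z -> above_diag m (Y + Z).
Proof. by move=> hY hZ p q l; rewrite submxblockD hY // hZ // addr0. Qed.

Lemma above_diagN m Z : above_diag m Z -> above_diag m (- Z).
Proof. by move=> hZ p q l; rewrite submxblockN hZ // oppr0. Qed.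

Lemma above_diagZ m a Z : above_diag m Z -> above_diag m (a *: Z).
Proof. by move=> hZ p q l; rewrite submxblockZ hZ // scaler0. Qed.

Lemma above_diag_sum m (r : seq nat) (P : pred nat) (Z : nat -> 'M[F]_n) :
    (forall i, P i -> above_diag m (Z i)) ->
  above_diag m (\sum_(i <- r | P i) Z i).
Proof.
move=> hZ; apply: (big_ind (above_diag m)) => //; first exact: above_diag0.
exact: above_diagD.
Qed.

Lemma above_diagW m m' Z : (m' <= m)%N -> above_diag m Z -> above_diag m' Z.
Proof.
move=> le_m hZ p q l; apply: hZ; apply: leq_trans l _.
by rewrite leq_add2l.
Qed.

Lemma above_diagM m m' Y Z :
  above_diag m Y -> above_diag m' Z -> above_diag (m + m') (Y *m Z).
Proof.
move=> hY hZ p q l; rewrite submxblockM big1 // => r _.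
have [lt_r|le_r] := ltnP r (p + m)%N; first by rewrite hY // mul0mx.
rewrite hZ ?mulmx0 //; apply: leq_trans l _.
by rewrite addnA leq_add2r.
Qed.

Lemma above_diagX Z j : above_diag 1 Z -> above_diag j (Z ^+ j).
Proof.
move=> hZ; elim: j => [|j IHj]; last by rewrite exprS; exact: (above_diagM hZ).
move=> p q; rewrite addn0 => lt_qp; apply/matrixP => a b; rewrite !mxE.
case: eqP => // /(congr1 (@tagnat.sig1 _ s)); rewrite !tagnat.Rank1K => e.
by move: lt_qp; rewrite e ltnn.
Qed.

Lemma above_diag_eq0 Z : above_diag k Z -> Z = 0.
Proof.
move=> hZ; apply/mxblockP => p q; rewrite submxblock0; apply: hZ.
by apply: leq_trans (ltn_ord q) _; rewrite leq_addl.
Qed.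

Lemma above_diag_nilpotent Z : above_diag 1 Z -> nilpotent_mx Z.
Proof. by move=> hZ; exists k; apply: above_diag_eq0; apply: above_diagX. Qed.

Lemma above_diagXB M Y Z j :
    above_diag 1 Y -> above_diag 1 Z -> above_diag M (Y - Z) ->
  above_diag (M + j) (Y ^+ j.+1 - Z ^+ j.+1).
Proof.
move=> hY hZ hYZ; elim: j => [|j IHj]; first by rewrite addn0 !expr1.
have -> : Y ^+ j.+2 - Z ^+ j.+2
    = Y *m (Y ^+ j.+1 - Z ^+ j.+1) + (Y - Z) *m Z ^+ j.+1.
  by rewrite mulmxBr mulmxBl addrA subrK !mulmxE -!exprS.
apply: above_diagD; last exact: above_diagM hYZ (above_diagX hZ).
by rewrite addnS -add1n; apply: above_diagM hY IHj.
Qed.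

Variable alpha : nat -> F.

(** The false block diagonal of index M of h(Y), for strictly upper triangular
Y, depends only on those of Y of smaller index. *)
Lemma higher_terms_above_diagB M Y Z :
    above_diag 1 Y -> above_diag 1 Z -> above_diag M (Y - Z) ->
  above_diag M.+1 (higher_terms alpha Y - higher_terms alpha Z).
Proof.
move=> hY hZ hYZ; rewrite /higher_terms -sumrB big_nat_cond.
apply: above_diag_sum => -[|[|j]] // _; rewrite -scalerBr.
apply: above_diagZ; apply: above_diagW (@above_diagXB _ _ _ j.+1 hY hZ hYZ).
by rewrite addnS ltnS leq_addr.
Qed.

(** * Nilpotent solutions are strictly upper triangular *)

Variable N : forall p, 'M[F]_(s p).
Hypothesis nilN : forall p, nilpotent_mx (N p).
Local Notation A := (shifted_diag N).

Lemma submxblock_commutator Z p q :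
  submxblock (Z *m A - A *m Z) p q
    = (q%:R - p%:R) *: submxblock Z p q
      + (submxblock Z p q *m N q - N p *m submxblock Z p q).
Proof.
rewrite submxblockB -{1 2}[Z]submxblockK /shifted_diag.
rewrite mul_mxblock_mxdiag mul_mxdiag_mxblock !mxblockK.
rewrite mulmxDr mulmxDl mul_mx_scalar mul_scalar_mx scalerBl.
by rewrite opprD addrACA.
Qed.

Lemma above_diag_commutator m Z : above_diag m Z -> above_diag m (Z *m A - A *m Z).
Proof.
move=> hZ p q l.
by rewrite submxblock_commutator hZ // scaler0 mul0mx mulmx0 subrr addr0.
Qed.

Lemma nilpotent_solution_strictly_upper X :
  nilpotent_solution alpha A X -> above_diag 1 X.
Proof.
move=> [[r Xr] eqX]; set f := X + higher_terms alpha X in eqX.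
have comXf : GRing.comm X f.
  apply: commrD => //; rewrite /higher_terms; apply: commr_sum => i _.
  by rewrite /GRing.comm -!mulmxE -scalemxAr -scalemxAl !mulmxE -exprS exprSr.
(* Downward induction on the exponent m + 1; j bounds its distance to r. *)
suff H j m : (r <= m.+1 + j)%N -> above_diag 1 (X ^+ m.+1).
  by rewrite -[X]expr1; apply: (H r 0%N); rewrite leq_addl.
elim: j m => [|j IHj] m le_r.
  rewrite addn0 in le_r; rewrite -(subnK le_r) exprD Xr mulr0.
  exact: above_diag0.
have eqXm := commutator_exp m comXf eqX.
rewrite {1}/f mulrDr -exprSr mulrnDl in eqXm.
have up_g : above_diag 1 ((X ^+ m * higher_terms alpha X) *+ m.+1).
  rewrite -scaler_nat; apply: above_diagZ.
  rewrite /higher_terms -mulmxE mulmx_sumr big_nat_cond.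
  apply: above_diag_sum => -[|[|i]] // _; rewrite -scalemxAr mulmxE -exprD.
  apply: above_diagZ; rewrite addnS; apply: IHj; apply: leq_trans le_r _.
  by rewrite !addSn !addnS !addSn ltnS ltnS leq_add2r leq_addr.
move=> p q; rewrite addn1 ltnS => le_qp.
have c0 : q%:R - (p + m.+1)%:R != 0 :> F.
  by rewrite subr_eq0 eqr_nat ltn_eqF // addnS ltnS (leq_trans le_qp) ?leq_addr.
apply: (sylvester_uniq c0 (nilN q) (nilN p)); rewrite /sylvester.
have := congr1 (fun Z => submxblock Z p q) eqXm.
rewrite /= -!mulmxE submxblock_commutator submxblockD up_g; last by rewrite addn1.
rewrite addr0 -scaler_nat submxblockZ => e.
rewrite mulmxDr mul_mx_scalar natrD opprD addrA scalerBl.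
by rewrite -[LHS]addrA addrAC e subrr.
Qed.

(** * Constructing solutions one false block diagonal at a time *)

(** The defect E(Y) of Y as a solution of YA - AY = Y + h(Y). *)
Definition residual Y : 'M[F]_n := Y *m A - A *m Y - (Y + higher_terms alpha Y).

Lemma residualP Y : above_diag 1 Y ->
  residual Y = 0 <-> nilpotent_solution alpha A Y.
Proof.
move=> hY; rewrite /residual; split=> [/subr0_eq e | [_ ->]]; last by rewrite subrr.
by split=> //; apply: above_diag_nilpotent.
Qed.

Lemma residualD Y Z :
  residual (Y + Z) = residual Y + (Z *m A - A *m Z - Z)
                     - (higher_terms alpha (Y + Z) - higher_terms alpha Y).
Proof.
rewrite /residual mulmxDl mulmxDr.
move: (Y *m A) (A *m Y) (Z *m A) (A *m Z) (higher_terms _ _) (higher_terms _ _).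
move=> a b c d e f.
apply/matrixP => i j; rewrite !mxE; ring.
Qed.

(** Solving the Sylvester equations of index M cancels the false block diagonal
of index M of the residual and leaves the earlier ones zero. *)
Lemma residual_correction M Y Z :
    (0 < M)%N -> above_diag 1 Y -> above_diag M Z -> above_diag M (residual Y) ->
    (forall p q : 'I_k, q = (p + M)%N :> nat ->
       sylvester ((M.-1%:R)%:M + N q) (N p)
         (- submxblock (residual Y) p q) (submxblock Z p q)) ->
  above_diag M.+1 (residual (Y + Z)).
Proof.
move=> M0 hY hZ hE eqZ; rewrite residualD.
have hYZ : above_diag 1 (Y + Z) by apply: above_diagD hY (above_diagW M0 hZ).
apply: above_diagD; last first.
  apply/above_diagN/(higher_terms_above_diagB hYZ hY).
  by rewrite addrAC subrr add0r.
move=> p q; rewrite addnS ltnS leq_eqVlt => /orP[/eqP e|l]; last first.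
  rewrite submxblockD hE // add0r submxblockB hZ // subr0.
  exact: (above_diag_commutator hZ).
rewrite submxblockD (submxblockB _ Z) submxblock_commutator.
move: (eqZ p q e); rewrite /sylvester mulmxDr mul_mx_scalar => eZ.
apply/eqP; rewrite addrC addr_eq0 -eZ e natrD -(prednK M0) mulrSr /=.
rewrite [p%:R + _]addrC addrK scalerDl scale1r; apply/eqP.
apply/matrixP => i j; rewrite !mxE; ring.
Qed.

(** The matrix with blocks z p q on the false block diagonal of index M and 0
elsewhere. *)
Definition false_diag (M : nat)
    (z : forall p q : 'I_k, 'M[F]_(s p, s q)) : 'M[F]_n :=
  \mxblock_(p < k, q < k) (if q == (p + M)%N :> nat then z p q else 0).

Lemma above_false_diag M z : above_diag M (false_diag M z).
Proof. by move=> p q l; rewrite mxblockK ltn_eqF. Qed.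

Lemma submxblock_false_diag M z (p q : 'I_k) :
  q = (p + M)%N :> nat -> submxblock (false_diag M z) p q = z p q.
Proof. by move=> e; rewrite mxblockK e eqxx. Qed.

(** An approximate solution can be corrected to an exact one without touching
its false block diagonals below M. The bound 1 < M makes the scalar M - 1
nonzero, so that every remaining Sylvester equation is solvable. *)
Lemma complete_solution M Y :
    (1 < M)%N -> above_diag 1 Y -> above_diag M (residual Y) ->
  exists Y', [/\ above_diag 1 Y', residual Y' = 0 & above_diag M (Y' - Y)].
Proof.
move: {2}(k - M)%N (leqnn (k - M)) => j; elim: j M Y => [|j IHj] M Y le_j M1 hY hE.
  exists Y; split=> //; last by rewrite subrr; apply: above_diag0.
  apply: above_diag_eq0; apply: above_diagW hE.
  by rewrite -subn_eq0 -leqn0.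
have c0 : M.-1%:R != 0 :> F by rewrite pnatr_eq0; case: (M) M1 => [|[]].
have ex p q : exists x,
    x *m ((M.-1%:R)%:M + N q) - N p *m x == - submxblock (residual Y) p q.
  have [x eqx] := sylvester_exists c0 (nilN q) (nilN p)
                    (- submxblock (residual Y) p q).
  by exists x; apply/eqP.
pose Z := false_diag M (fun p q => xchoose (ex p q)).
have hZ : above_diag M Z by apply: above_false_diag.
have M0 : (0 < M)%N by apply: ltnW.
have [||||Y' [hY' E0 hYY']] := IHj M.+1 (Y + Z).
- by rewrite subnS; case: (k - M)%N le_j.
- by rewrite ltnS.
- by apply: above_diagD hY (above_diagW M0 hZ).
- apply: residual_correction => // p q e.
  rewrite submxblock_false_diag //; apply/eqP; exact: (xchooseP (ex p q)).
exists Y'; split=> //.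
have -> : Y' - Y = Y' - (Y + Z) + Z by rewrite opprD addrA subrK.
by apply: above_diagD hZ; apply: above_diagW hYY'.
Qed.

Lemma above_lower_diags d X : above_diag 1 (lower_diags d X).
Proof.
by move=> p q; rewrite addn1 ltnS => l; rewrite mxblockK ltnNge l.
Qed.

Lemma above_diag_lower_diagsB d X :
  above_diag 1 X -> above_diag d (X - lower_diags d X).
Proof.
move=> hX p q l; rewrite submxblockB mxblockK l andbT.
case: ltnP => [_|le_qp]; first by rewrite subrr.
by rewrite subr0 hX // addn1 ltnS.
Qed.

Lemma submxblock_lower_diags d X (p q : 'I_k) :
  q = (p + d)%N :> nat -> submxblock (lower_diags d X) p q = 0.
Proof. by move=> e; rewrite mxblockK e ltnn andbF. Qed.

(** The block (p, p + d) of the equation, where h(X) may be replaced by the value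
of h at the truncation of X below index d. *)
Lemma solution_diag_sylvester d X (p q : 'I_k) :
    above_diag 1 X -> residual X = 0 -> (0 < d)%N -> q = (p + d)%N :> nat ->
  diag_sylvester alpha N d X (submxblock X p q).
Proof.
move=> hX E0 d0 e.
have := higher_terms_above_diagB hX (above_lower_diags d X)
          (above_diag_lower_diagsB hX).
move=> /(_ p q); rewrite addnS ltnS e leqnn => /(_ isT)/eqP.
rewrite submxblockB subr_eq0 => /eqP eh.
rewrite /diag_sylvester /sylvester -eh.
have := congr1 (fun Z => submxblock Z p q) E0.
rewrite /residual submxblock0 submxblockB submxblock_commutator submxblockD.
have d1 : d%:R = (d.-1)%:R + 1 :> F by rewrite -mulrSr prednK.
move/subr0_eq; rewrite e natrD d1 => eqXpq.
apply: (addrI (submxblock X p q)); rewrite -eqXpq mulmxDr mul_mx_scalar.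
apply/matrixP => i j; rewrite !mxE; ring.
Qed.

Lemma residual_lower_diags d X :
    above_diag 1 X -> residual X = 0 ->
  above_diag d (residual (lower_diags d X)).
Proof.
move=> hX E0; set L := lower_diags d X.
have hL : above_diag 1 L := above_lower_diags d X.
have hLX : above_diag d (L - X).
  by rewrite -opprB; apply/above_diagN/above_diag_lower_diagsB.
have eL : L = X + (L - X) by rewrite addrC subrK.
rewrite eL residualD -eL E0 add0r.
apply: above_diagD.
  by apply: above_diagD (above_diagN hLX); apply: above_diag_commutator.
apply/above_diagN/(above_diagW (leqnSn d)).
exact: higher_terms_above_diagB.
Qed.

(** Any solutions of the Sylvester equations of index d come from a nilpotent
solution with the same lower false block diagonals as X. For d = 1 these
equations are singular, so that solution need not be X. *)
Lemma extend_solution d X (x : forall p q : 'I_k, 'M[F]_(s p, s q)) :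
    above_diag 1 X -> residual X = 0 -> (0 < d)%N ->
    (forall p q : 'I_k, q = (p + d)%N :> nat ->
       diag_sylvester alpha N d X (x p q)) ->
  exists Y, [/\ nilpotent_solution alpha A Y, same_lower_diags d X Y
              & forall p q : 'I_k, q = (p + d)%N :> nat ->
                  submxblock Y p q = x p q].
Proof.
move=> hX E0 d0 eqx; pose L := lower_diags d X; pose Z := false_diag d x.
have hL : above_diag 1 L := above_lower_diags d X.
have hZ : above_diag d Z := @above_false_diag d x.
(* On the diagonal of index d, L vanishes and its residual is - h(L). *)
have hE : above_diag d.+1 (residual (L + Z)).
  apply: residual_correction => // [|p q e]; first exact: residual_lower_diags.
  rewrite submxblock_false_diag // /sylvester (eqx p q e) /residual submxblockB.
  rewrite submxblock_commutator submxblockD submxblock_lower_diags //.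
  by rewrite scaler0 mul0mx mulmx0 subrr addr0 sub0r add0r opprK.
have hLZ : above_diag 1 (L + Z) by apply: above_diagD hL (above_diagW d0 hZ).
have [Y [hY EY hYLZ]] := complete_solution (d0 : (1 < d.+1)%N) hLZ hE.
have eqY (p q : 'I_k) : (q <= p + d)%N ->
    submxblock Y p q = submxblock L p q + submxblock Z p q.
  move=> l; rewrite -submxblockD; apply/subr0_eq; rewrite -submxblockB.
  by apply: hYLZ; rewrite addnS ltnS.
exists Y; split=> [|p q /andP[lpq l]|p q e]; first exact/residualP.
  by rewrite eqY ?(ltnW l) // hZ // addr0 mxblockK lpq l.
by rewrite eqY ?e // submxblock_lower_diags // add0r submxblock_false_diag.
Qed.

End Blocks.

Theorem proposition2 (R : realType) (k : nat) (s : 'I_k -> nat)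
    (hs : forall p : 'I_k, (0 < s p)%N)
    (hn : (2 <= \sum_(p < k) s p)%N)
    (N : forall p : 'I_k, 'M[R[i]]_(s p))
    (hN : forall p : 'I_k, nilpotent_mx (N p))
    (alpha : nat -> R[i])
    (X : 'M[R[i]]_(\sum_(p < k) s p))
    (hX : nilpotent_solution alpha (shifted_diag N) X) :
  strictly_upper_block X /\
  forall d : nat, (1 <= d <= k - 1)%N ->
    (forall p q : 'I_k, q = (p + d)%N :> nat ->
       diag_sylvester alpha N d X (submxblock X p q)) /\
    (forall x : (forall p q : 'I_k, 'M[R[i]]_(s p, s q)),
       (forall p q : 'I_k, q = (p + d)%N :> nat ->
          diag_sylvester alpha N d X (x p q)) ->
       exists Y : 'M[R[i]]_(\sum_(p < k) s p),
         [/\ nilpotent_solution alpha (shifted_diag N) Y,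
             same_lower_diags d X Y
           & forall p q : 'I_k, q = (p + d)%N :> nat ->
               submxblock Y p q = x p q]).
Proof.
have upX := nilpotent_solution_strictly_upper hN hX.
have E0 : residual alpha N X = 0 by apply/residualP.
split=> [|d /andP[d0 _]]; first exact/strictly_upperP.
split=> [p q e|x eqx]; first exact: solution_diag_sylvester.
exact: extend_solution.
Qed.
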